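(* Let $D$ be a doubly partial order. Then the phylogeny graph $P(D)$ of $D$ is an interval graph.
   Context: All graphs and digraphs are finite and simple. For $x\in\mathbb{R}^2$ write $x=(x_1,x_2)$, and for $x,y\in\mathbb{R}^2$ write $x\prec y$ if $x_1<y_1$ and $x_2<y_2$. A digraph $D$ is a doubly partial order if there is a finite set $V\subseteq\mathbb{R}^2$ with $V(D)=V$ and $A(D)=\{(x,v)\mid v,x\in V,\ v\prec x\}$. For a vertex $x$, $N^+_D(x)=\{v\in V(D)\mid (x,v)\in A(D)\}$. The phylogeny graph $P(D)$ is the simple undirected graph with $V(P(D))=V(D)$ and $E(P(D))=\{xy\mid x\neq y,\ N^+_D(x)\cap N^+_D(y)\neq\emptyset\}\cup\{xy\mid (x,y)\in A(D)\}$. A graph $G$ is an interval graph if there is an assignment of real closed intervals $J(v)$ to the vertices $v$ such that for distinct $v,w$, $vw\in E(G)$ iff $J(v)\cap J(w)\neq\emptyset$. *)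

(* Defs.v *)
From HB Require Import structures.
From mathcomp Require Import all_boot all_order all_algebra finmap.
From mathcomp Require Import classical_sets set_interval reals.

Set Implicit Arguments.
Unset Strict Implicit.
Unset Printing Implicit Defensive.

Import Order.TTheory GRing.Theory Num.Theory.

Local Open Scope fset_scope.
Local Open Scope ring_scope.

Record digraph (T : choiceType) := Digraph {
  dvertices : {fset T};
  darcs : {fset T * T};
  darcs_sub : darcs `<=` dvertices `*` dvertices;
  darcs_irr : forall x, (x, x) \notin darcs
}.

Record sgraph (T : choiceType) := SGraph {
  vertices : {fset T};
  adj : rel T;
  adj_sub : forall x y, adj x y -> (x \in vertices) && (y \in vertices);
  adj_sym : symmetric adj;
  adj_irr : irreflexive adj
}.

Definition out_nbrs (T : choiceType) (D : digraph T) (x : T) : {fset T} :=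
  [fset v in dvertices D | (x, v) \in darcs D].

Section Phylogeny.
Variables (T : choiceType) (D : digraph T).

(* An edge is an unordered pair, so an arc in either direction makes x and y
   adjacent. *)
Definition phylogeny_adj : rel T := fun x y =>
  [&& x \in dvertices D, y \in dvertices D &
      [|| (x != y) && (out_nbrs D x `&` out_nbrs D y != fset0),
          (x, y) \in darcs D | (y, x) \in darcs D]].

Lemma phylogeny_adj_sub x y :
  phylogeny_adj x y -> (x \in dvertices D) && (y \in dvertices D).
Proof. by case/and3P => -> ->. Qed.

Lemma phylogeny_adj_sym : symmetric phylogeny_adj.
Proof.
move=> x y; rewrite /phylogeny_adj andbCA eq_sym fsetIC.
by rewrite [((x, y) \in _) || _]orbC.
Qed.

Lemma phylogeny_adj_irr : irreflexive phylogeny_adj.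
Proof.
move=> x; rewrite /phylogeny_adj eqxx /= (negbTE (darcs_irr D x)) /=.
by rewrite !andbF.
Qed.

Definition phylogeny_graph : sgraph T :=
  SGraph phylogeny_adj_sub phylogeny_adj_sym phylogeny_adj_irr.

End Phylogeny.

Definition prec (R : realType) (x y : R * R) : bool :=
  (x.1 < y.1) && (x.2 < y.2).

Definition doubly_partial_order (R : realType) (D : digraph (R * R)%type) : Prop :=
  exists V : {fset R * R},
    dvertices D = V /\
    darcs D = [fset p in V `*` V | prec p.2 p.1].

Definition closed_interval (R : realType) (I : set R) : Prop :=
  exists a b : R, a <= b /\ I = `[a, b]%classic.

Definition interval_graph (R : realType) (T : choiceType) (G : sgraph T) : Prop :=
  exists J : T -> set R,
    (forall v, v \in vertices G -> closed_interval (J v)) /\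
    (forall v w, v \in vertices G -> w \in vertices G -> v != w ->
       (adj G v w <-> (J v `&` J w !=set0)%classic)).

(* Main.v *)
Require Import Defs.
From mathcomp Require Import all_boot all_order all_algebra finmap.
From mathcomp Require Import classical_sets set_interval reals.
From mathcomp Require Import lra.

Import Order.TTheory GRing.Theory Num.Theory.

Local Open Scope fset_scope.
Local Open Scope ring_scope.

(** Two distinct vertices are adjacent in the phylogeny graph iff some
    [prec]-minimal vertex lies weakly below both.  The minimal vertices form an
    antichain, on which the key [v.1 - v.2] is injective and orders the vertices
    from upper left to lower right; the minimal vertices weakly below a given
    vertex are consecutive for this order.  The hulls of their keys are the
    required intervals: if two hulls meet, the larger of the two left endpoints
    is the key of a minimal vertex weakly below both vertices. *)

Lemma seq_arg_min (d : Order.disp_t) (R : orderType d) (T : eqType) (f : T -> R)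
    (s : seq T) (x : T) :
  x \in s -> exists2 y, y \in s & forall z, z \in s -> (f y <= f z)%O.
Proof.
elim: s x => // a [|b s] IHs x _.
  by exists a; rewrite ?mem_head // => z; rewrite inE => /eqP ->.
have [y ys ymin] := IHs b (mem_head _ _).
have [le_ay | lt_ya] := leP (f a) (f y).
  exists a; rewrite ?mem_head // => z; rewrite inE => /predU1P [-> // | zs].
  exact: le_trans le_ay (ymin z zs).
exists y; first by rewrite inE ys orbT.
by move=> z; rewrite inE => /predU1P [-> | /ymin //]; apply: ltW.
Qed.

Section MinimalVertices.
Variables (R : realType) (V : {fset R * R}).
Implicit Types u v w x y : R * R.

Definition key v : R := v.1 - v.2.

Definition preceq v x := (v == x) || prec v x.

Definition minimal v := all (fun u => ~~ prec u v) V.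

Definition min_below x : {fset R * R} :=
  [fset v in V | minimal v && preceq v x].

Lemma preceq_trans v x y : preceq v x -> preceq x y -> preceq v y.
Proof.
case/predU1P => [-> // | /andP [h1 h2]] /predU1P [<- | /andP [k1 k2]].
  by rewrite /preceq /prec h1 h2 orbT.
by rewrite /preceq /prec (lt_trans h1 k1) (lt_trans h2 k2) orbT.
Qed.

Lemma minimalP v u : minimal v -> u \in V -> ~~ prec u v.
Proof. by move/allP; apply. Qed.

Lemma min_belowP x v :
  reflect [/\ v \in V, minimal v & preceq v x] (v \in min_below x).
Proof. by rewrite !inE; apply: and3P. Qed.

Lemma min_below_sub x y : preceq x y -> min_below x `<=` min_below y.
Proof.
move=> xy; apply/fsubsetP => v /min_belowP [vV mv vx].
by apply/min_belowP; split=> //; apply: preceq_trans xy.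
Qed.

Lemma min_below_exists x : x \in V -> exists v, v \in min_below x.
Proof.
move=> xV; pose s := [fset v in V | preceq v x].
have xs : x \in s by rewrite !inE xV /preceq eqxx.
have [v vs vmin] := seq_arg_min _ _ _ (fun v => v.1 + v.2) s x xs.
move: (vs); rewrite !inE => /andP [vV vx].
exists v; apply/min_belowP; split=> //; apply/allP => u uV; apply/negP => uv.
have := vmin u; rewrite !inE uV (@preceq_trans u v x) //; last first.
  by rewrite /preceq uv orbT.
by move=> /(_ isT); case/andP: uv; lra.
Qed.

Lemma minimal_key_le u v : u \in V -> v \in V -> minimal u -> minimal v ->
  key u <= key v -> u.1 <= v.1 /\ v.2 <= u.2.
Proof.
move=> uV vV mu mv; rewrite /key => kuv.
have := minimalP u v mu vV; have := minimalP v u mv uV.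
rewrite /prec !negb_and -!leNgt => /orP [] h /orP [] k; split; lra.
Qed.

Lemma minimal_key_inj u v : u \in V -> v \in V -> minimal u -> minimal v ->
  key u = key v -> u = v.
Proof.
case: u v => [u1 u2] [v1 v2] uV vV mu mv kuv.
have [|/= h1 h2] := minimal_key_le _ _ uV vV mu mv; first by rewrite kuv.
have [|/= k1 k2] := minimal_key_le _ _ vV uV mv mu; first by rewrite kuv.
by congr pair; apply/le_anti/andP.
Qed.

Lemma min_below_minimal x v : minimal x -> v \in min_below x -> v = x.
Proof.
move=> mx /min_belowP [vV _ /predU1P [// | vx]].
by have := minimalP x v mx vV; rewrite vx.
Qed.

Lemma min_below_convex x u v w : v \in min_below x -> w \in min_below x ->
  u \in V -> minimal u -> key v <= key u <= key w -> u \in min_below x.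
Proof.
move=> vx wx uV mu /andP [kvu kuw].
have [mx | nmx] := boolP (minimal x).
  have vE := min_below_minimal x v mx vx; have wE := min_below_minimal x w mx wx.
  have /min_belowP [vV mv _] := vx.
  rewrite (minimal_key_inj u v) //; apply/le_anti/andP.
  by split=> //; rewrite vE -wE.
have strict z : z \in min_below x -> [/\ z \in V, minimal z & prec z x].
  case/min_belowP=> zV mz /predU1P [zx | //].
  by rewrite -zx mz in nmx.
have [vV mv /andP [_ v2]] := strict v vx.
have [wV mw /andP [w1 _]] := strict w wx.
have [_ h2] := minimal_key_le v u vV uV mv mu kvu.
have [h1 _] := minimal_key_le u w uV wV mu mw kuw.
apply/min_belowP; split=> //.
by rewrite /preceq /prec (le_lt_trans h1 w1) (le_lt_trans h2 v2) orbT.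
Qed.

Definition key_hull x : set R :=
  [set r | exists v w,
     [/\ v \in min_below x, w \in min_below x & key v <= r <= key w]]%classic.

Lemma key_hull_closed x : x \in V -> closed_interval (key_hull x).
Proof.
move=> /min_below_exists [v0 v0x].
have [a ax amin] := seq_arg_min _ _ _ key _ _ v0x.
have [b bx bmax] := seq_arg_min _ _ _ (fun v => - key v) _ _ v0x.
exists (key a), (key b); split; first exact: amin.
apply/seteqP; split=> r /=; rewrite in_itv /=; last by exists a, b.
move=> [v [w [vx wx /andP [vr rw]]]].
rewrite (le_trans (amin v vx) vr) /=; apply: le_trans rw _.
by rewrite -lerN2; apply: bmax.
Qed.

Lemma key_hull_meet x y :
  (key_hull x `&` key_hull y !=set0)%classic <->
  exists v, v \in min_below x `&` min_below y.
Proof.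
split=> [[r [[v [w [vx wx /andP [vr rw]]]] [v' [w' [vy wy /andP [vr' rw']]]]]]|].
  have /min_belowP [vV mv _] := vx; have /min_belowP [vV' mv' _] := vy.
  have [le_vv' | lt_v'v] := leP (key v) (key v').
    exists v'; rewrite inE vy andbT.
    by apply: (min_below_convex x v' v w); rewrite // le_vv' (le_trans vr').
  exists v; rewrite inE vx.
  by apply: (min_below_convex y v v' w'); rewrite // (ltW lt_v'v) (le_trans vr).
move=> [v]; rewrite inE => /andP [vx vy].
by exists (key v); split; exists v, v; rewrite lexx.
Qed.

End MinimalVertices.

Lemma phylogeny_adj_min_below (R : realType) (D : digraph (R * R)%type) x y :
  darcs D = [fset p in dvertices D `*` dvertices D | prec p.2 p.1] ->
  x \in dvertices D -> y \in dvertices D -> x != y ->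
  phylogeny_adj D x y <->
  exists v, v \in min_below R (dvertices D) x `&` min_below R (dvertices D) y.
Proof.
set V := dvertices D => arcsE xV yV xy.
have arcE u v : u \in V -> v \in V -> ((u, v) \in darcs D) = prec v u.
  by move=> uV vV; rewrite arcsE !inE /= uV vV.
have common z : z \in V -> preceq R z x -> preceq R z y ->
    exists v, v \in min_below R V x `&` min_below R V y.
  move=> /min_below_exists [v vz] zx zy; exists v; rewrite inE.
  by rewrite !(fsubsetP (min_below_sub R V z _ _) v vz).
rewrite /phylogeny_adj xV yV xy /= !arcE //; split.
  case/or3P => [/fset0Pn [v] | yx | xy'].
  - rewrite !inE => /andP [/andP [vV]] xv /andP [_ yv].
    by apply: (common v) => //; rewrite /preceq -arcE ?xv ?yv ?orbT.
  - by apply: (common y); rewrite // /preceq ?eqxx ?yx ?orbT.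
  - by apply: (common x); rewrite // /preceq ?eqxx ?xy' ?orbT.
move=> [v]; rewrite inE => /andP [/min_belowP [vV _ vx] /min_belowP [_ _ vy]].
case/predU1P: vx => [vx | vx]; case/predU1P: vy => [vy | vy].
- by rewrite -vx -vy eqxx in xy.
- by rewrite -vx vy !orbT.
- by rewrite -vy vx orbT.
- by apply/or3P/Or31/fset0Pn; exists v; rewrite !inE !arcE // vV vx vy.
Qed.

Theorem theorem2p1 (R : realType) (D : digraph (R * R)%type) :
  doubly_partial_order D -> interval_graph R (phylogeny_graph D).
Proof.
move=> [V [<- arcsE]]; exists (key_hull R (dvertices D)); split=> /=.
  exact: key_hull_closed.
move=> x y xV yV xy.
by rewrite key_hull_meet; apply: phylogeny_adj_min_below.
Qed.
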